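(* The following hold. (1) Consider, for $\lambda>0$ and $L\in(0,1)$, the property $P(\lambda,L)$: whenever $E\subset\mathbb{H}$ is a $\lambda$-vertical curve and $W\subset\mathbb{H}$ is a vertical plane, there is an entire $L$-iLip graph $\Gamma$ over $W$ such that $E\subset\Gamma$. Then for every $\lambda>0$ there is an $L\in(0,1)$ such that $P(\lambda,L)$ holds, and for every $L\in(0,1)$ there is a $\lambda>0$ such that $P(\lambda,L)$ holds. (2) Consider, for $\lambda>0$ and $L\in(0,1)$, the property $Q(\lambda,L)$: whenever $E\subset\mathbb{H}$ is an $L$-iLip graph over $W$ for every vertical plane $W$, then $E$ is a $\lambda$-vertical curve. Then for every $\lambda>0$ there is an $L\in(0,1)$ such that $Q(\lambda,L)$ holds, and for every $L\in(0,1)$ there is a $\lambda>0$ such that $Q(\lambda,L)$ holds.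
   Context: $\mathbb{H}$ is the first Heisenberg group, identified with $\mathbb{R}^3$ with the group law $(x,y,z)(x',y',z')=\left(x+x',y+y',z+z'+\tfrac12(xy'-x'y)\right)$ and identity $\mathbf{0}$. The Kor\'anyi norm is $|(x,y,z)|_{\mathrm{Kor}}=\sqrt[4]{(x^2+y^2)^2+16z^2}$ and the distance is $d(a,b)=|b^{-1}a|_{\mathrm{Kor}}$; $d(p,W)=\inf_{w\in W}d(p,w)$. For $\lambda>0$, $\mathrm{VCone}_\lambda=\{(x,y,z)\in\mathbb{H}: |z|\ge\lambda(x^2+y^2)\}$. A set $E\subset\mathbb{H}$ is a $\lambda$-vertical curve if $E\subset p\,\mathrm{VCone}_\lambda$ for all $p\in E$. A vertical plane (two-dimensional vertical subgroup) is a set $W=\{(x,y,z): ax+by=0\}$ with $(a,b)\neq(0,0)$. For $L\in(0,1)$, $\mathrm{Cone}_{W,L}=\{p\in\mathbb{H}: d(p,W)\le L\,d(\mathbf{0},p)\}$. A set $E\subset\mathbb{H}$ is an $L$-iLip (intrinsic $L$-Lipschitz) graph over $W$ if $E\subset p\,\mathrm{Cone}_{W,L}$ for all $p\in E$. Let $W^\perp\subset\{z=0\}$ be the one-parameter horizontal subgroup orthogonal to $W$; then $\mathbb{H}=W\cdot W^\perp$, and $\Pi_W\colon\mathbb{H}\to W$ denotes the projection $\Pi_W(wv)=w$ for $w\in W$, $v\in W^\perp$. An $L$-iLip graph $E$ over $W$ is entire if $\Pi_W(E)=W$. *)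

(* Defs.v *)
From HB Require Import structures.
From mathcomp Require Import all_boot all_order all_algebra.
From mathcomp Require Import all_classical all_reals all_analysis.
From mathcomp Require Import ring lra.

Set Implicit Arguments.
Unset Strict Implicit.
Unset Printing Implicit Defensive.

Import Order.TTheory GRing.Theory Num.Theory.

Local Open Scope classical_set_scope.
Local Open Scope ring_scope.

(* An alias of R * R * R, so that the group law below does not interfere with
   the componentwise structures carried by products. *)
Definition heis (R : realType) : Type := (R * R * R)%type.

HB.instance Definition _ (R : realType) := Choice.on (heis R).

Section HeisenbergGroup.
Variable R : realType.
Implicit Types p q r : heis R.

Definition hx p : R := p.1.1.
Definition hy p : R := p.1.2.
Definition hz p : R := p.2.

Definition heis_one : heis R := (0, 0, 0).
Definition heis_inv p : heis R := (- hx p, - hy p, - hz p).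
Definition heis_mul p q : heis R :=
  (hx p + hx q, hy p + hy q,
   hz p + hz q + 2^-1 * (hx p * hy q - hx q * hy p)).

Lemma heis_mulA : associative heis_mul.
Proof. by move=> p q r; rewrite /heis_mul /hx /hy /hz /=; do 2?congr pair; ring. Qed.

Lemma heis_mul1 : left_id heis_one heis_mul.
Proof.
move=> [[x y] z]; rewrite /heis_mul /hx /hy /hz /=; do 2?congr pair; ring.
Qed.

Lemma heis_mulr1 : right_id heis_one heis_mul.
Proof.
move=> [[x y] z]; rewrite /heis_mul /hx /hy /hz /=; do 2?congr pair; ring.
Qed.

Lemma heis_mulV : left_inverse heis_one heis_inv heis_mul.
Proof.
move=> [[x y] z]; rewrite /heis_mul /heis_inv /heis_one /hx /hy /hz /=.
by do 2?congr pair; ring.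
Qed.

Lemma heis_mulrV : right_inverse heis_one heis_inv heis_mul.
Proof.
move=> [[x y] z]; rewrite /heis_mul /heis_inv /heis_one /hx /hy /hz /=.
by do 2?congr pair; ring.
Qed.

End HeisenbergGroup.

HB.instance Definition _ (R : realType) := isGroup.Build (heis R)
  (@heis_mulA R) (@heis_mul1 R) (@heis_mulr1 R) (@heis_mulV R) (@heis_mulrV R).

Section HeisenbergGeometry.
Variable R : realType.
Implicit Types (p q w v : heis R) (E W A Gamma : set (heis R)) (lambda L : R).

Definition koranyi p : R :=
  ((hx p ^+ 2 + hy p ^+ 2) ^+ 2 + 16 * hz p ^+ 2) `^ (4^-1).

Definition hdist p q : R := koranyi (q^-1 * p)%g.

Definition hdist_set p W : R := inf [set hdist p w | w in W].

Definition ltranslate p A : set (heis R) := [set (p * q)%g | q in A].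

Definition vcone lambda : set (heis R) :=
  [set p | lambda * (hx p ^+ 2 + hy p ^+ 2) <= `|hz p|].

Definition vertical_curve lambda E : Prop :=
  forall p, E p -> E `<=` ltranslate p (vcone lambda).

Definition vertical_plane W : Prop :=
  exists a b : R, (a, b) <> (0, 0) /\ W = [set p | a * hx p + b * hy p = 0].

Definition plane_cone W L : set (heis R) :=
  [set p | hdist_set p W <= L * hdist 1%g p].

Definition ilip_graph W L E : Prop :=
  forall p, E p -> E `<=` ltranslate p (plane_cone W L).

Definition plane_perp W : set (heis R) :=
  [set v | hz v = 0 /\
     forall w, W w -> hx v * hx w + hy v * hy w + hz v * hz w = 0].

(* The value 1 is a junk default: when W is a vertical plane, the factor w
   exists and is unique (see plane_projP and plane_proj_mul). *)
Definition plane_proj W p : heis R :=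
  xget 1%g [set w | W w /\ exists2 v, plane_perp W v & p = (w * v)%g].

Definition entire_ilip_graph W L E : Prop :=
  ilip_graph W L E /\ plane_proj W @` E = W.

Definition vertical_curve_extends lambda L : Prop :=
  forall E W, vertical_curve lambda E -> vertical_plane W ->
  exists Gamma, entire_ilip_graph W L Gamma /\ E `<=` Gamma.

Definition ilip_graphs_vertical lambda L : Prop :=
  forall E, (forall W, vertical_plane W -> ilip_graph W L E) ->
  vertical_curve lambda E.

Lemma sqr_norm_neq0 (a b : R) : (a, b) <> (0, 0) -> a ^+ 2 + b ^+ 2 != 0.
Proof.
move=> ab0; apply/eqP => /eqP.
rewrite paddr_eq0 ?sqr_ge0// !sqrf_eq0 => /andP[/eqP a0 /eqP b0].
by apply: ab0; rewrite a0 b0.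
Qed.

Lemma plane_perpE (a b : R) : (a, b) <> (0, 0) ->
  plane_perp [set p | a * hx p + b * hy p = 0] =
  [set (t * a, t * b, 0) | t in [set: R]].
Proof.
move=> /sqr_norm_neq0 ab0; apply/seteqP; split=> [[[x y] z]|_ [t _ <-]].
- rewrite /plane_perp /hx /hy /hz /= => -[-> /(_ (- b, a, 0))] /=.
  have -> : a * - b + b * a = 0 by ring.
  move=> /(_ erefl) H.
  have {}H : y * a = x * b by lra.
  exists ((x * a + y * b) / (a ^+ 2 + b ^+ 2)) => //.
  congr pair; congr pair; apply/(mulIf ab0).
  + by rewrite mulrAC divfK// mulrDl -mulrA (mulrAC y) H; ring.
  + by rewrite mulrAC divfK// mulrDl -mulrA (mulrC a) mulrA -H; ring.
- rewrite /plane_perp /hx /hy /hz /=; split=> // w Ww.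
  have -> : t * a * w.1.1 + t * b * w.1.2 + 0 * w.2 =
            t * (a * w.1.1 + b * w.1.2) by ring.
  by rewrite Ww mulr0.
Qed.

Lemma plane_proj_exists W p : vertical_plane W ->
  exists w, W w /\ exists2 v, plane_perp W v & p = (w * v)%g.
Proof.
move=> [a [b [ab0 ->]]]; rewrite (plane_perpE ab0).
have n0 := sqr_norm_neq0 ab0.
pose t := (hx p * a + hy p * b) / (a ^+ 2 + b ^+ 2).
have tE : t * (a ^+ 2 + b ^+ 2) = hx p * a + hy p * b by rewrite divfK.
pose v : heis R := (t * a, t * b, 0).
exists (p * v^-1)%g; split.
  change (a * (hx p - t * a) + b * (hy p - t * b) = 0).
  transitivity (hx p * a + hy p * b - t * (a ^+ 2 + b ^+ 2)); first by ring.
  by rewrite tE subrr.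
by exists v; [exists t | rewrite mulgVK].
Qed.

Lemma plane_proj_unique W w v w' v' : vertical_plane W ->
  W w -> W w' -> plane_perp W v -> plane_perp W v' ->
  (w * v = w' * v')%g -> w = w'.
Proof.
move=> [a [b [ab0 ->]]]; rewrite (plane_perpE ab0).
have n0 := sqr_norm_neq0 ab0.
move=> /= Ww Ww' [t _ <-] [t' _ <-] e.
have ex : hx w + t * a = hx w' + t' * a := congr1 (@hx R) e.
have ey : hy w + t * b = hy w' + t' * b := congr1 (@hy R) e.
suff tt' : t = t' by move: e; rewrite tt' => /mulIg.
apply: (mulIf n0).
have : a * (hx w + t * a) + b * (hy w + t * b) =
       a * (hx w' + t' * a) + b * (hy w' + t' * b) by rewrite ex ey.
by lra.
Qed.

Lemma plane_projP W p : vertical_plane W ->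
  W (plane_proj W p) /\
  exists2 v, plane_perp W v & p = (plane_proj W p * v)%g.
Proof.
move=> vW; rewrite /plane_proj; case: xgetP => [w _ //|noW].
by have [w /noW] := plane_proj_exists p vW.
Qed.

Lemma plane_proj_mul W w v : vertical_plane W -> W w -> plane_perp W v ->
  plane_proj W (w * v)%g = w.
Proof.
move=> vW Ww Pv; have [Wp [v' Pv' e]] := plane_projP (w * v)%g vW.
by apply/esym; exact: (plane_proj_unique vW Ww Wp Pv Pv' e).
Qed.

End HeisenbergGeometry.

(* Main.v *)
Require Import Defs.
From mathcomp Require Import all_boot all_order all_algebra.
From mathcomp Require Import all_classical all_reals all_analysis.
From mathcomp Require Import ring lra.

(** In coordinates adapted to a vertical plane [W] with unit normal [(a, b)],
    write [nrm p] and [tng p] for the components of [p] along the normal and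
    along the horizontal direction of [W].  The distance from [p] to [W] is
    [`|nrm p|] (lemma [hdist_nplane]), so the cone condition on [p] is the
    polynomial inequality
    [nrm p ^+ 4 <= L ^+ 4 * ((nrm p ^+ 2 + tng p ^+ 2) ^+ 2 + 16 * hz p ^+ 2)].

    For the second part, take [W] orthogonal to the horizontal component of
    [g := p^-1 * q].  Then [tng g = 0] and the inequality becomes a lower bound
    of [`|hz g|] by a multiple of [hx g ^+ 2 + hy g ^+ 2], that is, [g] lies in
    a vertical cone; see [ilip_graphs_vertical_of].

    The first part is an extension theorem.  Consider the open wedge
    [K := {p | `|tng p| < 2 lambda nrm p, `|hz p| < lambda nrm p ^+ 2}]
    around the positive normal ray.  Its two bounds are balanced so that [K] is
    a semigroup (lemma [wedgeM]); hence [p^-1 * q \in K] is a strict partial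
    order on the group, and it is left invariant.  It is disjoint from the
    [lambda]-vertical cone, so a [lambda]-vertical curve is an antichain [E].
    The boundary of the up-set [E * K] in the direction of the normal is again
    an antichain (lemma [frontier_antichain]), it contains [E] (lemma
    [sub_frontier]), and it meets every coset of the normal line (lemma
    [frontier_meets_line]), which says that its projection to [W] is onto.
    Finally, the elements outside [K] and its inverse satisfy the cone condition
    as soon as [1 <= L ^+ 4 * (1 + 8 * lambda ^+ 2)] (lemma
    [not_wedge_plane_cone]), so antichains are [L]-iLip graphs.  The inequality
    can be solved for either of [L < 1] and [lambda]. *)

Set Implicit Arguments.
Unset Strict Implicit.
Unset Printing Implicit Defensive.

Import Order.TTheory GRing.Theory Num.Theory.

Local Open Scope classical_set_scope.
Local Open Scope ring_scope.

(* Keeps simplification from exposing the triple behind a group product. *)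
#[local] Arguments hx : simpl never.
#[local] Arguments hy : simpl never.
#[local] Arguments hz : simpl never.

(** * Coordinates and the Koranyi norm *)

Section Preliminaries.
Variable R : realType.
Implicit Types (p q : heis R) (A : set (heis R)).

Lemma heisP p q : hx p = hx q -> hy p = hy q -> hz p = hz q -> p = q.
Proof.
move: p q => [[x y] z] [[x' y'] z'].
by rewrite /hx /hy /hz /= => -> -> ->.
Qed.

Lemma hxM p q : hx (p * q)%g = hx p + hx q. Proof. by []. Qed.
Lemma hyM p q : hy (p * q)%g = hy p + hy q. Proof. by []. Qed.
Lemma hzM p q :
  hz (p * q)%g = hz p + hz q + 2^-1 * (hx p * hy q - hx q * hy p).
Proof. by []. Qed.
Lemma hxV p : hx p^-1%g = - hx p. Proof. by []. Qed.
Lemma hyV p : hy p^-1%g = - hy p. Proof. by []. Qed.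
Lemma hzV p : hz p^-1%g = - hz p. Proof. by []. Qed.

Lemma ltranslateE p A q : ltranslate p A q <-> A (p^-1 * q)%g.
Proof.
split=> [[g Ag <-]|Apq]; first by rewrite mulKg.
by exists (p^-1 * q)%g => //; rewrite mulVKg.
Qed.

Lemma koranyi_ge0 p : 0 <= koranyi p.
Proof. exact: powR_ge0. Qed.

Lemma koranyi4 p :
  koranyi p ^+ 4 = (hx p ^+ 2 + hy p ^+ 2) ^+ 2 + 16 * hz p ^+ 2.
Proof.
have h : 0 <= (hx p ^+ 2 + hy p ^+ 2) ^+ 2 + 16 * hz p ^+ 2.
  by rewrite addr_ge0 ?sqr_ge0// mulr_ge0 ?sqr_ge0.
by rewrite -powR_mulrn ?koranyi_ge0// -powRrM mulVf// powRr1.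
Qed.

(** Taking fourth powers removes the root from the norm, so every comparison
    below is polynomial. *)
Lemma le_norm_koranyi (s L : R) p : 0 <= L ->
  (`|s| <= L * koranyi p) =
  (s ^+ 4 <= L ^+ 4 * ((hx p ^+ 2 + hy p ^+ 2) ^+ 2 + 16 * hz p ^+ 2)).
Proof.
move=> L0; rewrite -koranyi4 -exprMn.
rewrite -(@ler_pXn2r _ 4 _ (`|s|)) ?nnegrE ?mulr_ge0 ?koranyi_ge0//.
by rewrite -normrX ger0_norm// exprn_even_ge0.
Qed.

End Preliminaries.

(** * Coordinates adapted to a vertical plane *)

Section UnitNormal.
Variables (R : realType) (a b : R).
Hypothesis ab1 : a ^+ 2 + b ^+ 2 = 1.
Implicit Types (p q w : heis R) (E : set (heis R)) (lambda L : R).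

Definition nplane : set (heis R) := [set p | a * hx p + b * hy p = 0].

Definition nrm p := a * hx p + b * hy p.
Definition tng p := a * hy p - b * hx p.
Definition hline (t : R) : heis R := (t * a, t * b, 0).

Lemma ab_neq0 : (a, b) <> (0, 0).
Proof.
by move=> [a0 b0]; move/eqP: ab1; rewrite a0 b0 expr0n addr0 eq_sym oner_eq0.
Qed.

Lemma nplane_vertical : vertical_plane nplane.
Proof. by exists a, b; split; [exact: ab_neq0|]. Qed.

Lemma nrmM p q : nrm (p * q)%g = nrm p + nrm q.
Proof. by rewrite /nrm hxM hyM; ring. Qed.
Lemma tngM p q : tng (p * q)%g = tng p + tng q.
Proof. by rewrite /tng hxM hyM; ring. Qed.
Lemma nrmV p : nrm p^-1%g = - nrm p.
Proof. by rewrite /nrm hxV hyV; ring. Qed.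
Lemma tngV p : tng p^-1%g = - tng p.
Proof. by rewrite /tng hxV hyV; ring. Qed.

(** The passage from [(hx, hy)] to [(nrm, tng)] is a rotation, so it preserves
    both the area form of the group law and the Euclidean norm below. *)
Lemma hzM_nt p q :
  hz (p * q)%g = hz p + hz q + 2^-1 * (nrm p * tng q - nrm q * tng p).
Proof.
rewrite hzM /nrm /tng; congr (_ + _ * _).
by transitivity ((a ^+ 2 + b ^+ 2) * (hx p * hy q - hx q * hy p));
  [rewrite ab1 mul1r|ring].
Qed.

Lemma sqr_nt p : hx p ^+ 2 + hy p ^+ 2 = nrm p ^+ 2 + tng p ^+ 2.
Proof.
rewrite /nrm /tng; transitivity ((a ^+ 2 + b ^+ 2) * (hx p ^+ 2 + hy p ^+ 2));
  [by rewrite ab1 mul1r|ring].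
Qed.

Lemma nrm_hline t : nrm (hline t) = t.
Proof.
by rewrite /nrm /hline /hx /hy /= -[RHS](mulr1 t) -ab1; ring.
Qed.
Lemma tng_hline t : tng (hline t) = 0.
Proof. by rewrite /tng /hline /hx /hy /=; ring. Qed.
Lemma hz_hline t : hz (hline t) = 0. Proof. by []. Qed.

Lemma hlineD s t : hline (s + t) = (hline s * hline t)%g.
Proof.
apply: heisP; rewrite ?hxM ?hyM ?hzM /hline /hx /hy /hz /=; ring.
Qed.
Lemma hlineN t : hline (- t) = (hline t)^-1%g.
Proof.
apply: heisP; rewrite ?hxV ?hyV ?hzV /hline /hx /hy /hz /=; ring.
Qed.

(** Left translation by [W] leaves [nrm p] unchanged, and [nrm] is bounded by
    the Koranyi norm; the value [`|nrm p|] is attained at the projection of [p]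
    along the normal line, where the remaining factor is [hline (nrm p)]. *)
Lemma hdist_nplane p : hdist_set p nplane = `|nrm p|.
Proof.
have lb : lbound [set hdist p w | w in nplane] `|nrm p|.
  move=> _ [w Ww <-].
  rewrite /hdist -[X in _ <= X]mul1r le_norm_koranyi// expr1n mul1r.
  have nE : nrm (w^-1 * p)%g = nrm p by rewrite nrmM nrmV [nrm w]Ww oppr0 add0r.
  rewrite sqr_nt nE.
  set t := tng _; set z := hz _; nra.
apply/eqP; rewrite eq_le; apply/andP; split; last first.
  apply: lb_le_inf => //; exists (hdist p 1%g), 1%g => //.
  by rewrite /nplane /= /hx /hy /= !mulr0 addr0.
apply: ge_inf; first by exists `|nrm p|.
exists (p * hline (- nrm p))%g.
  by rewrite /nplane /= -/(nrm _) nrmM nrm_hline subrr.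
rewrite /hdist hlineN invgM invgK mulgVK.
apply/eqP; rewrite -(@eqrXn2 _ 4) ?koranyi_ge0// koranyi4 sqr_nt.
rewrite nrm_hline tng_hline hz_hline -normrX ger0_norm ?exprn_even_ge0//.
by apply/eqP; ring.
Qed.

Lemma plane_coneE L p : 0 <= L ->
  plane_cone nplane L p <->
  nrm p ^+ 4 <= L ^+ 4 * ((nrm p ^+ 2 + tng p ^+ 2) ^+ 2 + 16 * hz p ^+ 2).
Proof.
move=> L0; rewrite /plane_cone /= hdist_nplane.
have -> : hdist 1%g p = koranyi p^-1%g by rewrite /hdist mulg1.
by rewrite le_norm_koranyi// sqr_nt nrmV tngV hzV !sqrrN.
Qed.

(** * The wedge semigroup *)

(** The slope [2 * lambda] is the largest for which the bound on [hz] is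
    stable under products; see [wedgeM]. *)
Definition wedge lambda : set (heis R) :=
  [set p | (`|tng p| : R) < 2 * lambda * nrm p /\
           (`|hz p| : R) < lambda * nrm p ^+ 2].

Section Wedge.
Variable lambda : R.
Hypothesis lambda_gt0 : 0 < lambda.
Local Notation K := (wedge lambda).

Lemma wedge_nrm_gt0 p : K p -> 0 < nrm p.
Proof.
move=> [tp _]; have := le_lt_trans (normr_ge0 _) tp.
by rewrite pmulr_rgt0// mulr_gt0.
Qed.

(** The area term of [p * q] is below
    [2^-1 * (2 * lambda + 2 * lambda) * (nrm p * nrm q)], which is exactly the
    cross term of [lambda * (nrm p + nrm q) ^+ 2]. *)
Lemma wedgeM p q : K p -> K q -> K (p * q)%g.
Proof.
move=> Kp Kq; have np := wedge_nrm_gt0 Kp; have nq := wedge_nrm_gt0 Kq.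
move: Kp Kq => [+ +] [+ +].
rewrite /wedge /= nrmM tngM hzM_nt !ltr_norml.
move: (nrm p) (nrm q) (tng p) (tng q) (hz p) (hz q) np nq.
move=> x x' y y' z z' x0 x0'.
move=> /andP[y1 y2] /andP[z1 z2] /andP[y1' y2'] /andP[z1' z2'].
have h1 : x * y' < 2 * lambda * (x * x').
  by rewrite mulrCA ltr_pM2l.
have h2 : - (2 * lambda * (x * x')) < x * y'.
  by rewrite mulrCA -mulrN ltr_pM2l.
have h3 : x' * y < 2 * lambda * (x * x').
  by rewrite [x * x']mulrC mulrCA ltr_pM2l.
have h4 : - (2 * lambda * (x * x')) < x' * y.
  by rewrite [x * x']mulrC mulrCA -mulrN ltr_pM2l.
have -> : lambda * (x + x') ^+ 2 =
  lambda * x ^+ 2 + lambda * x' ^+ 2 + 2 * lambda * (x * x') by ring.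
by split; apply/andP; split; lra.
Qed.

Lemma wedge_hline s : 0 < s -> K (hline s).
Proof.
move=> s0; rewrite /wedge /= nrm_hline tng_hline hz_hline normr0.
by rewrite !mulr_gt0// exprn_gt0.
Qed.

Lemma hz_mul_hline p t : `|hz (p * hline t)%g - hz p| = 2^-1 * `|t| * `|tng p|.
Proof.
rewrite hzM_nt nrm_hline tng_hline hz_hline.
have -> : hz p + 0 + 2^-1 * (nrm p * 0 - t * tng p) - hz p =
  - (2^-1 * t * tng p) by ring.
by rewrite normrN !normrM ger0_norm ?invr_ge0.
Qed.

Lemma hz_hline_mul p t : `|hz (hline t * p)%g - hz p| = 2^-1 * `|t| * `|tng p|.
Proof.
rewrite hzM_nt nrm_hline tng_hline hz_hline.
have -> : 0 + hz p + 2^-1 * (t * tng p - nrm p * 0) - hz p =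
  2^-1 * t * tng p by ring.
by rewrite !normrM ger0_norm ?invr_ge0.
Qed.

(** Multiplication by [hline t] on either side moves [hz] by the same amount up
    to sign, so one estimate serves both sides. *)
Lemma wedge_shift p t :
  (`|tng p| : R) < 2 * lambda * (nrm p + t) ->
  (`|hz p| : R) + 2^-1 * `|t| * `|tng p| < lambda * (nrm p + t) ^+ 2 ->
  K (p * hline t)%g /\ K (hline t * p)%g.
Proof.
move=> ht hzp.
have shift q : nrm q = nrm p + t -> tng q = tng p ->
    `|hz q - hz p| = 2^-1 * `|t| * `|tng p| -> K q.
  move=> nq tq zq; rewrite /wedge /= nq tq; split=> //.
  apply: le_lt_trans hzp; rewrite -zq.
  by rewrite -[X in `|X| <= _](subrKC (hz p)) ler_normD.
split; apply: shift; rewrite ?nrmM ?tngM ?nrm_hline ?tng_hline ?addr0 ?add0r//.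
- exact: hz_mul_hline.
- by rewrite addrC.
- exact: hz_hline_mul.
Qed.

(** A form of the openness of the wedge: its strict bounds leave room for a
    small step back along the normal line, on either side. *)
Lemma wedge_shrink p : K p ->
  exists2 e, 0 < e & K (p * hline (- e))%g /\ K (hline (- e) * p)%g.
Proof.
move=> Kp; have x0 := wedge_nrm_gt0 Kp; case: Kp => tp zp.
set x := nrm p in x0 tp zp *; set y : R := `|tng p| in tp.
set z : R := `|hz p| in zp.
have kx0 : 0 < lambda * x by rewrite mulr_gt0.
(* [e1] controls the bound on [tng]; in [e2], the factor 3 splits as 2 from the
   loss in [lambda * (x - e) ^+ 2] and 1 from the area term, which is at most
   [e * (lambda * x)]. *)
pose e1 := (2 * lambda * x - y) / (4 * lambda).
pose e2 := (lambda * x ^+ 2 - z) / (3 * (lambda * x)).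
have e10 : 0 < e1 by rewrite divr_gt0 ?subr_gt0// mulr_gt0.
have e20 : 0 < e2 by rewrite divr_gt0 ?subr_gt0// mulr_gt0.
pose e := Num.min e1 e2.
have e0 : 0 < e by rewrite lt_min e10.
have he1 : e * (4 * lambda) <= 2 * lambda * x - y.
  by rewrite -ler_pdivlMr ?mulr_gt0// /e ge_min lexx.
have he2 : e * (3 * (lambda * x)) <= lambda * x ^+ 2 - z.
  by rewrite -ler_pdivlMr ?mulr_gt0// /e ge_min lexx orbT.
have le0 : 0 < e * lambda by rewrite mulr_gt0.
have ey : e * y < e * (2 * lambda * x) by rewrite ltr_pM2l.
have ee : 0 < lambda * e ^+ 2 by rewrite mulr_gt0// exprn_gt0.
exists e => //; apply: wedge_shift.
  by rewrite -/x -/y; nra.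
by rewrite -/x -/y -/z normrN gtr0_norm//; nra.
Qed.

(** Far along the normal line, [lambda * nrm ^+ 2] grows quadratically and the
    displacement of [hz] only linearly. *)
Lemma wedge_grow p : exists t, K (p * hline t)%g /\ K (hline t * p)%g.
Proof.
set x : R := `|nrm p|; set y : R := `|tng p|; set z : R := `|hz p|.
have x0 : 0 <= x := normr_ge0 _.
have y0 : 0 <= y := normr_ge0 _.
have z0 : 0 <= z := normr_ge0 _.
(* The shifted element has normal component [s], and [m] collects the terms
   that [lambda * s] has to dominate. *)
pose m := z + x * y + y.
have m0 : 0 <= m by rewrite /m !addr_ge0// mulr_ge0.
pose s := 1 + m / lambda.
have sE : lambda * s = lambda + m.
  by rewrite mulrDr mulr1 mulrC divfK// gt_eqF.
have s1 : 1 <= s by rewrite /s lerDl divr_ge0// ltW.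
exists (s - nrm p); apply: wedge_shift; rewrite [nrm p + _]addrC subrK -/y -/z.
  have xy : 0 <= x * y by rewrite mulr_ge0.
  by rewrite -mulrA sE /m; have := lambda_gt0; lra.
have hn : `|s - nrm p| <= s + x.
  by apply: le_trans (ler_normB _ _) _; rewrite ger0_norm//; lra.
have h1 : `|s - nrm p| * y <= (s + x) * y by rewrite ler_wpM2r.
rewrite expr2 mulrA sE.
have h2 : (lambda + m) * s = lambda * s + m * (s - 1) + m by ring.
have h3 : m * (s - 1) >= y * (s - 1).
  by rewrite ler_wpM2r ?subr_ge0// /m; nra.
have xy : 0 <= x * y by rewrite mulr_ge0.
have ys : 0 <= y * s by rewrite mulr_ge0//; lra.
have ls : 0 < lambda * s by rewrite mulr_gt0//; lra.
have mE : m = z + x * y + y by [].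
by rewrite h2; clearbody m s; lra.
Qed.

(** Outside [K] and its inverse, either [tng] or [hz] is large compared with
    [nrm].  With [X := nrm p ^+ 2], the quantity
    [(X + tng p ^+ 2) ^+ 2 + 16 * hz p ^+ 2] is then at least
    [(1 + 8 * lambda ^+ 2) * X ^+ 2] in the first case, by the cross term of the
    square, and [(1 + 16 * lambda ^+ 2) * X ^+ 2] in the second. *)
Lemma not_wedge_plane_cone L p : 0 <= L ->
  1 <= L ^+ 4 * (1 + 8 * lambda ^+ 2) ->
  ~ K p -> ~ K p^-1%g -> plane_cone nplane L p.
Proof.
move=> L0 hL nK nKV; apply/plane_coneE => //.
have nrm4 : nrm p ^+ 4 = (nrm p ^+ 2) ^+ 2 by rewrite -exprM.
have L40 : 0 <= L ^+ 4 by rewrite exprn_ge0.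
have cone_of : (1 + 8 * lambda ^+ 2) * (nrm p ^+ 2) ^+ 2 <=
    (nrm p ^+ 2 + tng p ^+ 2) ^+ 2 + 16 * hz p ^+ 2 ->
    nrm p ^+ 4 <= L ^+ 4 * ((nrm p ^+ 2 + tng p ^+ 2) ^+ 2 + 16 * hz p ^+ 2).
  move=> /(ler_wpM2l L40); apply: le_trans.
  by rewrite nrm4 mulrA ler_peMl// sqr_ge0.
have X0 : 0 <= nrm p ^+ 2 by rewrite sqr_ge0.
have Y0 : 0 <= tng p ^+ 2 by rewrite sqr_ge0.
have Z0 : 0 <= hz p ^+ 2 by rewrite sqr_ge0.
have [y_ge|y_lt] := lerP (2 * lambda * `|nrm p|) `|tng p|.
  apply: cone_of.
  have : (2 * lambda * `|nrm p|) ^+ 2 <= `|tng p| ^+ 2.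
    by have l0 := ltW lambda_gt0; rewrite ler_pXn2r ?nnegrE ?mulr_ge0//.
  rewrite exprMn !real_normK ?num_real// => Y_ge.
  have := ler_wpM2l X0 Y_ge.
  move: (nrm p ^+ 2) (tng p ^+ 2) (hz p ^+ 2) X0 Y0 Z0 => X Y Z X0 Y0 Z0 XY.
  have := sqr_ge0 Y; lra.
have [z_ge|z_lt] := lerP (lambda * nrm p ^+ 2) `|hz p|.
  apply: cone_of.
  have : (lambda * nrm p ^+ 2) ^+ 2 <= `|hz p| ^+ 2.
    by rewrite ler_pXn2r ?nnegrE ?(mulr_ge0 (ltW lambda_gt0))//.
  rewrite exprMn real_normK ?num_real// => Z_ge.
  have := mulr_ge0 X0 Y0; have := sqr_ge0 (tng p ^+ 2); lra.
have [np|np|np] := ltgtP (nrm p) 0.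
- case: nKV; rewrite /wedge /= nrmV tngV hzV !normrN sqrrN; split=> //.
  by rewrite -ltr0_norm.
- by case: nK; split=> //; rewrite -[X in _ * X]gtr0_norm.
- rewrite np expr0n /= mulr_ge0 ?exprn_ge0// addr_ge0 ?sqr_ge0//.
  by rewrite mulr_ge0 ?sqr_ge0.
Qed.

(** * Extension of antichains *)

Section Extension.
Variable E : set (heis R).

Definition above : set (heis R) := [set q | exists2 p, E p & K (p^-1 * q)%g].

(** This is the boundary of [above] along the normal lines.  Since [above] is
    open, the lower end of its trace on such a line does not belong to it. *)
Definition frontier : set (heis R) :=
  [set q | ~ above q /\ forall s, 0 < s -> above (q * hline s)%g].

Lemma aboveM q g : above q -> K g -> above (q * g)%g.
Proof.
by move=> [p Ep Kpq] Kg; exists p => //; rewrite mulgA; exact: wedgeM.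
Qed.

Lemma above_open q : above q -> exists2 e, 0 < e & above (q * hline (- e))%g.
Proof.
move=> [p Ep /wedge_shrink[e e0 [Ke _]]]; exists e => //; exists p => //.
by rewrite mulgA.
Qed.

(** If [q] were above [p], then, the wedge being open, it would be above a
    point [p * hline e] slightly farther along the normal; that point is
    already above [E], hence so would be [q]. *)
Lemma frontier_antichain p q : frontier p -> frontier q -> ~ K (p^-1 * q)%g.
Proof.
move=> [_ Fp] [nq _] /wedge_shrink[e e0 [_ Ke]]; apply: nq.
have -> : q = (p * hline e * (hline (- e) * (p^-1 * q)))%g.
  by rewrite hlineN -mulgA mulVKg mulVKg.
by apply: aboveM => //; exact: Fp.
Qed.

Hypothesis E_antichain : forall p q, E p -> E q -> ~ K (p^-1 * q)%g.

Lemma sub_frontier : E `<=` frontier.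
Proof.
move=> q Eq; split=> [[p Ep]|s s0]; first exact: E_antichain.
by exists q => //; rewrite mulKg; exact: wedge_hline.
Qed.

(** The part of a line that is above [E] is an up-set.  It is not empty since
    the line eventually enters [p * K] for a point [p] of [E].  It is bounded
    below since in the other direction the line enters [p * K^-1], from where
    the up-set would reach [p] itself, contrary to the antichain property.  Its
    infimum gives the point of the frontier. *)
Lemma frontier_meets_line w : E !=set0 -> exists t, frontier (w * hline t)%g.
Proof.
move=> [p Ep].
pose T := [set t | above (w * hline t)%g].
have up s t : T s -> s < t -> T t.
  move=> Ts st; have -> : t = s + (t - s) by rewrite subrKC.
  rewrite /T /= hlineD mulgA; apply: aboveM => //.
  by apply: wedge_hline; rewrite subr_gt0.
have T0 : T !=set0.
  have [t [Kt _]] := wedge_grow (p^-1 * w)%g.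
  by exists t, p => //; rewrite mulgA.
have Tlb : has_lbound T.
  have [t [_ Kt]] := wedge_grow (w^-1 * p)%g.
  exists (- t) => s Ts; rewrite leNgt; apply/negP => st.
  have : above p.
    have -> : p = (w * hline (- t) * (hline t * (w^-1 * p)))%g.
      by rewrite hlineN -mulgA mulKg mulVKg.
    by apply: aboveM => //; exact: up st.
  by case: (sub_frontier Ep).
exists (inf T); split.
  move=> /above_open[e e0]; rewrite -mulgA -hlineD => Te.
  have := ge_inf Tlb Te; lra.
move=> s s0; have [t Tt ts] := inf_adherent s0 (conj T0 Tlb).
by rewrite -mulgA -hlineD; exact: up ts.
Qed.

Lemma frontier_entire L : 0 <= L -> 1 <= L ^+ 4 * (1 + 8 * lambda ^+ 2) ->
  E !=set0 -> entire_ilip_graph nplane L frontier.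
Proof.
move=> L0 hL E0; split.
  move=> p Fp q Fq; apply/ltranslateE; apply: not_wedge_plane_cone => //.
    exact: frontier_antichain.
  by rewrite invgM invgK; exact: frontier_antichain.
have vW := nplane_vertical.
apply/seteqP; split=> [_ [p _ <-]|w Ww]; first by case: (plane_projP p vW).
have [t Ft] := frontier_meets_line w E0.
exists (w * hline t)%g => //; apply: plane_proj_mul => //.
by rewrite /nplane plane_perpE; [exists t|exact: ab_neq0].
Qed.

End Extension.

End Wedge.
End UnitNormal.

(** * Vertical curves and intrinsic Lipschitz graphs *)

Lemma normalize_pair (R : realType) (a b : R) : (a, b) <> (0, 0) ->
  exists r, 0 < r /\ r ^+ 2 = a ^+ 2 + b ^+ 2 /\
    (a / r) ^+ 2 + (b / r) ^+ 2 = 1.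
Proof.
move=> /sqr_norm_neq0 n0.
have n_ge0 : 0 <= a ^+ 2 + b ^+ 2 by rewrite addr_ge0 ?sqr_ge0.
have rE : Num.sqrt (a ^+ 2 + b ^+ 2) ^+ 2 = a ^+ 2 + b ^+ 2 by rewrite sqr_sqrtr.
exists (Num.sqrt (a ^+ 2 + b ^+ 2)); split; first by rewrite sqrtr_gt0 lt_def n0.
by split=> //; rewrite !expr_div_n rE -mulrDl divff.
Qed.

Lemma vertical_plane_unit (R : realType) (W : set (heis R)) : vertical_plane W ->
  exists a b : R, a ^+ 2 + b ^+ 2 = 1 /\ W = nplane a b.
Proof.
move=> [a [b [/normalize_pair[r [r0 [_ ab1]]] ->]]]; exists (a / r), (b / r).
split=> //; apply/seteqP; split=> p; rewrite /nplane /=.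
  by move=> e; rewrite mulrAC [_ / r * _]mulrAC -mulrDl e mul0r.
move=> e; apply: (@mulIf _ r^-1); first by rewrite invr_neq0// gt_eqF.
by rewrite mul0r -[RHS]e; ring.
Qed.

(** A vertical curve is an antichain for the wedge order of every vertical plane:
    in [K] one has [`|hz| < lambda * nrm ^+ 2], in the vertical cone
    [lambda * (nrm ^+ 2 + tng ^+ 2) <= `|hz|]. *)
Lemma vertical_curve_extends_of (R : realType) (lambda L : R) : 0 < lambda ->
  0 <= L -> 1 <= L ^+ 4 * (1 + 8 * lambda ^+ 2) ->
  vertical_curve_extends lambda L.
Proof.
move=> l0 L0 hL E W vE /vertical_plane_unit[a [b [ab1 ->]]].
wlog E0 : E vE / E !=set0.
  (* The frontier of the empty set is empty, so start from a point instead. *)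
  move=> wl; have [->|/set0P/(wl _ vE)//] := eqVneq E set0.
  have v1 : vertical_curve lambda [set 1%g : heis R].
    move=> _ -> _ ->; apply/ltranslateE.
    by rewrite mulVg /vcone /= /hx /hy /= expr0n /= addr0 mulr0.
  have [|Gamma [GammaP _]] := wl _ v1; first by exists 1%g.
  by exists Gamma; split=> //; exact: sub0set.
have antichain p q : E p -> E q -> ~ wedge a b lambda (p^-1 * q)%g.
  move=> Ep Eq [_]; apply/negP; rewrite -leNgt.
  have /ltranslateE := vE p Ep q Eq.
  rewrite /vcone /= (sqr_nt ab1); apply: le_trans.
  by rewrite ler_pM2l// lerDl sqr_ge0.
exists (frontier a b lambda E).
by split; [exact: frontier_entire|exact: sub_frontier].
Qed.

(** The plane to test is the one whose normal is the horizontal direction of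
    [g := p^-1 * q]: there [nrm g] is the full horizontal length [r], and the
    cone condition [r ^+ 4 <= L ^+ 4 * (r ^+ 4 + 16 * hz g ^+ 2)] bounds
    [hz g] from below.  If that direction vanishes, [g] is vertical. *)
Lemma ilip_graphs_vertical_of (R : realType) (lambda L : R) : 0 <= lambda ->
  0 < L -> 16 * lambda ^+ 2 * L ^+ 4 <= 1 - L ^+ 4 ->
  ilip_graphs_vertical lambda L.
Proof.
move=> l0 L0 hL E HE p Ep q Eq; apply/ltranslateE.
set g := (p^-1 * q)%g; rewrite /vcone /=.
have [[x0 y0]|] := pselect ((hx g, hy g) = (0, 0)).
  by rewrite x0 y0 expr0n addr0 mulr0.
move=> /normalize_pair[r [r0 [rE u1]]].
have /ltranslateE := HE _ (nplane_vertical u1) p Ep q Eq.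
move=> /(plane_coneE u1 _ (ltW L0)); rewrite -(sqr_nt u1) -/g.
have -> : nrm (hx g / r) (hy g / r) g = r.
  have r_neq0 : r != 0 by rewrite gt_eqF.
  apply: (mulIf r_neq0); rewrite -expr2 rE /nrm.
  by field.
rewrite -rE => cone.
rewrite -(@ler_pXn2r _ 2) ?nnegrE ?(mulr_ge0 l0) ?sqr_ge0//.
rewrite real_normK ?num_real// exprMn -exprM.
have L4 : 0 < L ^+ 4 by rewrite exprn_gt0.
have h : 16 * lambda ^+ 2 * L ^+ 4 * r ^+ 4 <= (1 - L ^+ 4) * r ^+ 4.
  by rewrite ler_wpM2r// exprn_ge0// ltW.
rewrite -(ler_pM2l L4); rewrite -exprM in cone; lra.
Qed.

(** Both relations between [L] and [lambda] that occur above are met when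
    [L ^+ 4] is the inverse of [1 + c * lambda ^+ 2] for a suitable constant. *)
Lemma ex_cone_aperture (R : realType) (c lambda : R) : 0 < c -> 0 < lambda ->
  exists L : R, 0 < L < 1 /\ L ^+ 4 * (1 + c * lambda ^+ 2) = 1.
Proof.
move=> c0 l0; have cl : 0 < c * lambda ^+ 2 by rewrite mulr_gt0// exprn_gt0.
have n0 : 0 < 1 + c * lambda ^+ 2 by rewrite addr_gt0.
have v0 : 0 < (1 + c * lambda ^+ 2)^-1 by rewrite invr_gt0.
have v1 : (1 + c * lambda ^+ 2)^-1 < 1 by rewrite invf_lt1// ltrDl.
exists (Num.sqrt (Num.sqrt (1 + c * lambda ^+ 2)^-1)); split.
  rewrite !sqrtr_gt0 v0 /= -[ltRHS]sqrtr1 ltr_sqrt//.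
  by rewrite -[ltRHS]sqrtr1 ltr_sqrt.
rewrite (exprM _ 2 2) sqr_sqrtr ?sqrtr_ge0// sqr_sqrtr ?(ltW v0)//.
by rewrite mulVf// gt_eqF.
Qed.

Theorem lemma1p2 (R : realType) :
  ((forall lambda : R, 0 < lambda ->
      exists L : R, 0 < L < 1 /\ vertical_curve_extends lambda L) /\
   (forall L : R, 0 < L < 1 ->
      exists lambda : R, 0 < lambda /\ vertical_curve_extends lambda L)) /\
  ((forall lambda : R, 0 < lambda ->
      exists L : R, 0 < L < 1 /\ ilip_graphs_vertical lambda L) /\
   (forall L : R, 0 < L < 1 ->
      exists lambda : R, 0 < lambda /\ ilip_graphs_vertical lambda L)).
Proof.
split; split.
- move=> lambda l0; have [L [L01 LE]] := ex_cone_aperture (ltr0Sn R 7) l0.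
  exists L; split=> //; apply: vertical_curve_extends_of => //.
    by case/andP: L01 => /ltW.
  by rewrite LE.
- move=> L /andP[L0 L1]; have L4 : 0 < L ^+ 4 by rewrite exprn_gt0.
  (* Then [L ^+ 4 * (8 * lambda ^+ 2) = 8]. *)
  exists (L ^- 2); split; first by rewrite invr_gt0 exprn_gt0.
  apply: vertical_curve_extends_of; rewrite ?invr_gt0 ?exprn_gt0 ?(ltW L0)//.
  rewrite exprVn -exprM mulrDr mulr1 mulrCA mulfV ?gt_eqF//; lra.
- move=> lambda l0; have [L [L01 LE]] := ex_cone_aperture (ltr0Sn R 15) l0.
  exists L; split=> //; have [L0 _] := andP L01.
  apply: ilip_graphs_vertical_of => //; lra.
- move=> L /andP[L0 L1]; have L4 : 0 < L ^+ 4 by rewrite exprn_gt0.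
  have L41 : L ^+ 4 < 1 by rewrite exprn_ilt1// ltW.
  have s0 : 0 < Num.sqrt (1 - L ^+ 4) by rewrite sqrtr_gt0 subr_gt0.
  (* Then [16 * lambda ^+ 2 * L ^+ 4 = (1 - L ^+ 4) * L ^+ 4], and [L ^+ 4 < 1]. *)
  exists (Num.sqrt (1 - L ^+ 4) / 4); split; first by rewrite divr_gt0.
  apply: ilip_graphs_vertical_of; rewrite ?divr_ge0 ?(ltW s0)//.
  rewrite expr_div_n sqr_sqrtr; last by rewrite subr_ge0 ltW.
  nra.
Qed.
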